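(* Let $G$ be a finite graph and let $H$ be an induced subgraph of $G$ such that at most one vertex of $H$ is adjacent to vertices of $G\setminus H$. Consider the ferromagnetic Ising model with no external field at inverse temperature $\beta\ge0$. Begin in the all ''$+$'' state and fix a mixing tolerance $\varepsilon\in(0,1)$ for continuous-time Glauber dynamics. Then $T_H(\varepsilon)\le T_{G|H}(\varepsilon)$.
   Context: The ferromagnetic Ising model on a finite graph $F$ with vertex set $V(F)$ (no external field, inverse temperature $\beta\ge0$) is the distribution $\pi_F$ on $\{+1,-1\}^{V(F)}$ with $\pi_F(\sigma)\propto\exp\bigl(\beta\sum_{u\sim v}\sigma_u\sigma_v\bigr)$, the sum being over edges of $F$. In continuous-time Glauber dynamics on $F$, each vertex has an independent rate-$1$ Poisson clock; when the clock at $v$ rings, the spin at $v$ is resampled from $\pi_F$ conditioned on the current spins of all other vertices. $T_H(\varepsilon)$ is the least time $t$ such that, for the Glauber dynamics on $H$ by itself (the rest of $G$ removed) started from the all $+$ configuration, the law at time $t$ is within total variation distance $\varepsilon$ of $\pi_H$. $T_{G|H}(\varepsilon)$ is the least time $t$ such that, for the Glauber dynamics on $G$ (with the same $\beta$) started from the all $+$ configuration, the law at time $t$ of the restriction of the configuration to the vertices of $H$ is within total variation distance $\varepsilon$ of the restriction (marginal) of $\pi_G$ to $H$. $G\setminus H$ denotes the vertices of $G$ not in $H$. *)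

(* Defs.v *)
From HB Require Import structures.
From mathcomp Require Import all_boot all_order all_algebra.
From mathcomp Require Import all_classical all_reals all_analysis.

Set Implicit Arguments.
Unset Strict Implicit.
Unset Printing Implicit Defensive.

Import Order.TTheory GRing.Theory Num.Theory.
Import numFieldNormedType.Exports.
Local Open Scope classical_set_scope.
Local Open Scope ring_scope.

(* [true] stands for the spin +1 and [false] for -1. *)
Definition config (V : finType) := {ffun V -> bool}.

Definition all_plus (V : finType) : config V := [ffun => true].

Definition spin (R : realType) (b : bool) : R := if b then 1 else -1.

Section Distributions.
Variables (R : realType) (T : finType).

Definition dirac_pmf (a x : T) : R := (x == a)%:R.

Definition tv_dist (mu nu : T -> R) : R :=
  \big[Num.max/0]_(A : {set T}) `|\sum_(x in A) mu x - \sum_(x in A) nu x|.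

(* The least time at which [mu t] is [eps]-close to [nu], as an extended real:
   it is +oo if there is no such time. *)
Definition first_time_within (eps : R) (mu : R -> T -> R) (nu : T -> R)
    : \bar R :=
  ereal_inf [set t%:E | t in [set t : R | 0 <= t /\ tv_dist (mu t) nu <= eps]].

End Distributions.

Section Ising.
Variables (R : realType) (V : finType) (e : rel V) (beta : R).

(* An undirected edge {u, v} occurs as the two ordered pairs (u, v) and (v, u),
   whence the factor 1/2. *)
Definition edge_sum (s : config V) : R :=
  2^-1 * \sum_(u : V) \sum_(v : V | e u v) spin R (s u) * spin R (s v).

Definition ising_weight (s : config V) : R := expR (beta * edge_sum s).

Definition ising (s : config V) : R :=
  ising_weight s / \sum_(s' : config V) ising_weight s'.

Definition agree_off (v : V) (s s' : config V) : bool :=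
  [forall u, (u != v) ==> (s u == s' u)].

Definition resample_kernel (v : V) (s s' : config V) : R :=
  if agree_off v s s'
  then ising s' / \sum_(r : config V | agree_off v s r) ising r
  else 0.

Definition resample (mu : config V -> R) (v : V) : config V -> R :=
  fun s' => \sum_(s : config V) mu s * resample_kernel v s s'.

(* The probability that the clocks rung during [0, t], in chronological order,
   are [w]: the numbers of rings of the clocks are independent Poisson(t)
   variables and, given these numbers, all the (size w)! / prod_v n_v!
   orderings are equally likely.  Poisson weights are spelled out because
   [poisson_pmf 0] is the constant 1, not the point mass at 0. *)
Definition clock_prob (t : R) (w : seq V) : R :=
  (\prod_(v : V) (expR (- t) * t ^+ count_mem v w / (count_mem v w)`!%:R))
  * ((\prod_(v : V) (count_mem v w)`!)%N%:R / (size w)`!%:R).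

(* The law at time [t] of the continuous-time dynamics started from [s0],
   obtained by conditioning on the sequence of clocks rung by time [t]. *)
Definition glauber_law (s0 : config V) (t : R) : config V -> R :=
  fun s => limn (series (fun k : nat =>
    \sum_(w : k.-tuple V)
      clock_prob t w * foldl resample (dirac_pmf R s0) w s)).

End Ising.

Section Subgraph.
Variables (R : realType) (V : finType) (H : {set V}).

Definition verts : finType := {x : V | x \in H}.

Definition induced_rel (e : rel V) : rel verts :=
  [rel x y : verts | e (val x) (val y)].

Definition restrict_config (s : config V) : config verts :=
  [ffun x : verts => s (val x)].

Definition marginal (mu : config V -> R) : config verts -> R :=
  fun s' => \sum_(s : config V | restrict_config s == s') mu s.

End Subgraph.

Arguments induced_rel {V} H e.
Arguments restrict_config {V} H s.
Arguments marginal {R V} H mu s'.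

Definition attachment (V : finType) (e : rel V) (H : {set V}) : {set V} :=
  [set x in H | [exists y, (y \notin H) && e x y]].

Definition mixing_time_sub (R : realType) (V : finType) (e : rel V)
    (H : {set V}) (beta eps : R) : \bar R :=
  first_time_within eps
    (glauber_law (induced_rel H e) beta (all_plus (verts H)))
    (ising (induced_rel H e) beta).

Definition mixing_time_restr (R : realType) (V : finType) (e : rel V)
    (H : {set V}) (beta eps : R) : \bar R :=
  first_time_within eps
    (fun t => marginal H (glauber_law e beta (all_plus V) t))
    (marginal H (ising e beta)).

(* Main.v *)
(* The marginal of the Ising measure p of G on H is the Ising measure q of H:
   flipping all the spins outside H exchanges the two values of the spin at the
   attachment vertex, so the total weight of the outside does not depend on it.
   A ring at v in H of the dynamics on H then acts as an update of G
   resampling v together with all the vertices outside H.  Replacing the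
   update of v alone by this larger update stochastically decreases a law
   whose density with respect to p is an increasing function of the spins on H,
   by the FKG inequality in the block
   (a censoring inequality in the sense of Peres and Winkler).  Applying this
   ring by ring, the law on H of the dynamics on G stochastically dominates the
   law of the dynamics on H at every time.  The latter has increasing density
   with respect to q, so its total variation distance to q is attained on an
   increasing event, whose excess probability is larger for the dynamics on G. *)
Require Import Defs.
From mathcomp Require Import all_boot all_order all_algebra.
From mathcomp Require Import all_classical all_reals all_analysis.
From mathcomp Require Import ring lra.

Set Implicit Arguments.
Unset Strict Implicit.
Unset Printing Implicit Defensive.

Import Order.TTheory GRing.Theory Num.Theory.
Import numFieldNormedType.Exports.
Local Open Scope classical_set_scope.
Local Open Scope ring_scope.

(** * Spin configurations and the FKG inequality *)

Definition config_le (V : finType) (s s' : config V) : Prop :=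
  forall u, s u -> s' u.

Definition increasing (R : realType) (V : finType) (f : config V -> R) : Prop :=
  forall s s', config_le s s' -> f s <= f s'.

Definition set_spin (V : finType) (v : V) (b : bool) (s : config V) : config V :=
  [ffun u => if u == v then b else s u].

(** The sites in [l] are free and all others frozen; a list allows induction on the free sites. *)
Definition fiber (V : finType) (l : seq V) (s : config V) : pred (config V) :=
  fun r => [forall u, (u \in l) || (r u == s u)].

Section Configurations.
Variables (V : finType).
Implicit Types (s r : config V) (u v : V) (l : seq V).

Lemma config_le_all_plus s : config_le s (all_plus V).
Proof. by move=> u; rewrite ffunE. Qed.

Lemma set_spin_idP v b s : (set_spin v b s == s) = (s v == b).
Proof.
apply/eqP/eqP => [<-|sv]; first by rewrite ffunE eqxx.
by apply/ffunP => u; rewrite ffunE; case: eqP => // ->.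
Qed.

Lemma set_spin_id v b s : s v = b -> set_spin v b s = s.
Proof. by move/eqP; rewrite -set_spin_idP => /eqP. Qed.

Lemma set_spinE v b s : set_spin v b s v = b.
Proof. by rewrite ffunE eqxx. Qed.

Lemma set_spinK v b c s : set_spin v b (set_spin v c s) = set_spin v b s.
Proof. by apply/ffunP => u; rewrite !ffunE; case: eqP. Qed.

Lemma set_spin_mono v b s s' :
  config_le s s' -> config_le (set_spin v b s) (set_spin v b s').
Proof. by move=> ss' u; rewrite !ffunE; case: eqP => // _; apply: ss'. Qed.

Lemma set_spin_false_le v s s' :
  config_le s s' -> config_le (set_spin v false s) s'.
Proof. by move=> ss' u; rewrite !ffunE; case: eqP => // _; apply: ss'. Qed.

Lemma set_spin_true_ge v s s' :
  config_le s s' -> config_le s (set_spin v true s').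
Proof. by move=> ss' u; rewrite !ffunE; case: eqP => // _; apply: ss'. Qed.

Lemma fiberP l s r : reflect (forall u, u \notin l -> r u = s u) (fiber l s r).
Proof.
apply: (iffP forallP) => [h u ul|h u]; first by move: (h u); rewrite (negPf ul) => /eqP.
by case: (boolP (u \in l)) => //= ul; rewrite h.
Qed.

Variables (R : realType).

Lemma sum_fiber_nil s (F : config V -> R) : \sum_(r | fiber [::] s r) F r = F s.
Proof.
rewrite (big_pred1 s) // => r; apply/fiberP/eqP => [h|-> //].
by apply/ffunP => u; rewrite h.
Qed.

Lemma sum_fiber_cons v l s (F : config V -> R) : v \notin l ->
  \sum_(r | fiber (v :: l) s r) F r =
    \sum_(r | fiber l (set_spin v true s) r) F r +
    \sum_(r | fiber l (set_spin v false s) r) F r.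
Proof.
move=> vl; rewrite (bigID (fun r : config V => r v)) /=; congr (_ + _).
  apply: eq_bigl => r; apply/andP/fiberP => [[/fiberP h rv] u ul|h].
    rewrite ffunE; case: (eqVneq u v) => [-> //|uv]; apply: h.
    by rewrite in_cons negb_or uv.
  split; last by rewrite h ?set_spinE.
  apply/fiberP => u; rewrite in_cons negb_or => /andP[uv ul].
  by rewrite h // ffunE (negPf uv).
apply: eq_bigl => r; apply/andP/fiberP => [[/fiberP h rv] u ul|h].
  rewrite ffunE; case: (eqVneq u v) => [->|uv]; first exact/negbTE.
  by apply: h; rewrite in_cons negb_or uv.
split; last by rewrite h ?set_spinE.
apply/fiberP => u; rewrite in_cons negb_or => /andP[uv ul].
by rewrite h // ffunE (negPf uv).
Qed.

Lemma sum_fiber_shift v l s (F : config V -> R) : v \notin l ->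
  \sum_(r | fiber l (set_spin v true s) r) F r =
  \sum_(r | fiber l (set_spin v false s) r) F (set_spin v true r).
Proof.
move=> vl; rewrite (reindex_onto (set_spin v true) (set_spin v false)) /=; last first.
  move=> r /fiberP h; rewrite set_spinK set_spin_id // h // set_spinE //.
apply: eq_bigl => r; rewrite set_spinK set_spin_idP; apply/andP/fiberP.
  move=> [/fiberP h /eqP rv] u ul; move: (h u ul); rewrite !ffunE.
  by case: eqP => // ->.
move=> h; split; last by rewrite h // set_spinE.
apply/fiberP => u ul; move: (h u ul); rewrite !ffunE.
by case: eqP => // ->.
Qed.

(** Each configuration arises exactly twice: from itself and from its flip at [v]. *)
Lemma sum_set_spin v (F : config V -> R) :
  \sum_s (F (set_spin v true s) + F (set_spin v false s)) = 2 * \sum_s F s.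
Proof.
have key b : \sum_s F (set_spin v b s) = 2 * \sum_(s : config V | s v == b) F s.
  rewrite (bigID (fun s : config V => s v == b)) /= mulr_natl mulr2n.
  congr (_ + _); first by apply: eq_bigr => s /eqP sv; rewrite set_spin_id.
  rewrite [RHS](reindex_onto (set_spin v b) (set_spin v (~~ b))) /=; last first.
    by move=> s sv; rewrite set_spinK set_spin_id //; apply/eqP.
  apply: eq_bigl => s; rewrite set_spinE eqxx set_spinK set_spin_idP /=.
  by case: (s v) b => -[].
rewrite big_split /= !key -mulrDr; congr (_ * _).
rewrite [RHS](bigID (fun s : config V => s v == true)) /=; congr (_ + _).
by apply: eq_bigl => s; case: (s v).
Qed.

End Configurations.

(** For positive [p], the ratio of [p (set_spin v true s)] to [p (set_spin v false s)] increases
    with [s]: the single-site form of the FKG lattice condition. *)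
Definition attractive (R : realType) (V : finType) (p : config V -> R) : Prop :=
  forall v s s', config_le s s' ->
    p (set_spin v true s) * p (set_spin v false s') <=
    p (set_spin v true s') * p (set_spin v false s).

Section Attractive.
Variables (R : realType) (V : finType) (p : config V -> R).
Hypothesis p_gt0 : forall s, 0 < p s.
Hypothesis p_attr : attractive p.

Lemma sum_fiber_gt0 l s : 0 < \sum_(r | fiber l s r) p r.
Proof.
rewrite (bigD1 s) /=; last exact/fiberP.
by rewrite ltr_pwDl // sumr_ge0 // => r _; apply: ltW.
Qed.

(* Conditioning on the spin at [v], the covariance is the sum of the two
   conditional covariances and of the covariance of the conditional means;
   the latter increase with the spin at [v] by the induction hypothesis
   applied to the increasing ratio p(r^{v+}) / p(r^{v-}). *)
Lemma FKG l s (f g : config V -> R) : uniq l -> increasing f -> increasing g ->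
  (\sum_(r | fiber l s r) p r * f r) * (\sum_(r | fiber l s r) p r * g r) <=
  (\sum_(r | fiber l s r) p r) * (\sum_(r | fiber l s r) p r * (f r * g r)).
Proof.
elim: l s f g => [|v l IH] s f g.
  by move=> _ _ _; rewrite !sum_fiber_nil mulrACA -mulrA.
move=> /= /andP[vl ul] fi gi; rewrite !sum_fiber_cons //.
set sp := set_spin v true s; set sm := set_spin v false s.
have mean h : increasing h ->
    (\sum_(r | fiber l sm r) p r * h r) * (\sum_(r | fiber l sp r) p r) <=
    (\sum_(r | fiber l sp r) p r * h r) * (\sum_(r | fiber l sm r) p r).
  move=> hi; pose rho r := p (set_spin v true r) / p (set_spin v false r).
  have rhoi : increasing rho.
    by move=> r r' rr'; rewrite /rho ler_pdivrMr // mulrAC ler_pdivlMr //; apply: p_attr.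
  have rhoE r : fiber l sm r -> p r * rho r = p (set_spin v true r).
    move=> /fiberP rsm; rewrite /rho (@set_spin_id _ v false) ?rsm ?set_spinE //.
    by rewrite mulrCA mulfV ?mulr1 // gt_eqF.
  have := IH sm h rho ul hi rhoi.
  rewrite (eq_bigr _ rhoE) -(sum_fiber_shift _ p vl) => /le_trans; apply.
  rewrite mulrC ler_wpM2r // ?(ltW (sum_fiber_gt0 _ _)) // sum_fiber_shift //.
  (* The weights are now those of the plus half; putting a plus at [v] in the argument of [h] only
     increases [h]. *)
  apply: ler_sum => r rf; rewrite mulrCA rhoE // mulrC ler_wpM2l ?(ltW (p_gt0 _)) //.
  exact/hi/set_spin_true_ge.
have := IH sp f g ul fi gi; have := IH sm f g ul fi gi.
have := mean f fi; have := mean g gi.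
have := sum_fiber_gt0 l sp; have := sum_fiber_gt0 l sm.
move: (\sum_(r | fiber l sp r) p r) (\sum_(r | fiber l sm r) p r) => a b.
move: (\sum_(r | fiber l sp r) p r * f r) (\sum_(r | fiber l sm r) p r * f r) => F F'.
move: (\sum_(r | fiber l sp r) p r * g r) (\sum_(r | fiber l sm r) p r * g r) => G G'.
move: (\sum_(r | fiber l sp r) p r * (f r * g r)) => FG.
move: (\sum_(r | fiber l sm r) p r * (f r * g r)) => FG'.
move=> b0 a0 hg hf IHm IHp.
have cov : 0 <= (F * b - F' * a) * (G * b - G' * a).
  by apply: mulr_ge0; rewrite subr_ge0.
rewrite -(ler_pM2l (mulr_gt0 a0 b0)) -subr_ge0.
(* The law of total covariance cleared of denominators; [a] and [b] are the masses of the plus and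
   minus halves. *)
rewrite (_ : _ - _ = (F * b - F' * a) * (G * b - G' * a)
  + b * (a + b) * (a * FG - F * G) + a * (a + b) * (b * FG' - F' * G')); last by ring.
have ab0 : 0 <= a + b by lra.
by rewrite !addr_ge0 // !mulr_ge0 ?subr_ge0 // ltW.
Qed.

End Attractive.

(** * Heat-bath updates *)

(** The conditional expectation of [g] under [p] given the spins away from [v]; it acts on
    observables, whereas [resample] acts on laws. *)
Definition heat_bath (R : realType) (V : finType) (p : config V -> R) (v : V)
    (g : config V -> R) (s : config V) : R :=
  (p (set_spin v true s) * g (set_spin v true s) +
   p (set_spin v false s) * g (set_spin v false s)) /
  (p (set_spin v true s) + p (set_spin v false s)).

Section HeatBath.
Variables (R : realType) (V : finType) (p : config V -> R).
Hypothesis p_gt0 : forall s, 0 < p s.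
Implicit Types (v : V) (s : config V) (f g : config V -> R).

Lemma two_spins_gt0 v s : 0 < p (set_spin v true s) + p (set_spin v false s).
Proof. exact: addr_gt0. Qed.

(** The measure enters only through the conditional probability of a plus at [v]; isolating it makes
    updates for different measures comparable. *)
Lemma heat_bath_affine v g s :
  heat_bath p v g s = g (set_spin v false s) +
    heat_bath p v (fun r => (r v)%:R) s *
      (g (set_spin v true s) - g (set_spin v false s)).
Proof.
rewrite /heat_bath !set_spinE /=; field.
exact/lt0r_neq0/two_spins_gt0.
Qed.

Lemma heat_bath_set_spin v b g s :
  heat_bath p v g (set_spin v b s) = heat_bath p v g s.
Proof. by rewrite /heat_bath !set_spinK. Qed.

Lemma heat_bath_increasing v g : attractive p -> increasing g ->
  increasing (heat_bath p v g).
Proof.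
move=> p_attr gi s s' ss'; rewrite /heat_bath.
rewrite ler_pdivrMr ?two_spins_gt0 // mulrAC ler_pdivlMr ?two_spins_gt0 //.
have := p_attr v _ _ ss'.
have := gi _ _ (set_spin_mono (v := v) (b := true) ss').
have := gi _ _ (set_spin_mono (v := v) (b := false) ss').
have : g (set_spin v false s') <= g (set_spin v true s').
  exact/gi/set_spin_false_le/set_spin_true_ge.
have := p_gt0 (set_spin v true s); have := p_gt0 (set_spin v false s).
have := p_gt0 (set_spin v true s'); have := p_gt0 (set_spin v false s').
move: (p (set_spin v true s)) (p (set_spin v false s)) => a b.
move: (p (set_spin v true s')) (p (set_spin v false s')) => a' b'.
move: (g (set_spin v true s)) (g (set_spin v false s)) => x y.
move: (g (set_spin v true s')) (g (set_spin v false s')) => x' y'.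
move=> b'0 a'0 b0 a0 yx' yy' xx' ab.
(* The first term is the gain from a larger chance of a plus, the second the gain from a larger
   configuration. *)
rewrite -subr_ge0 (_ : _ - _ = (a' * b - a * b') * (x' - y') +
  (a' + b') * (a * (x' - x) + b * (y' - y))); last by ring.
have [? ? ? ?] : [/\ 0 <= a, 0 <= b, 0 <= a' & 0 <= b'] by split; apply: ltW.
by rewrite addr_ge0 // mulr_ge0 ?subr_ge0 // addr_ge0 // mulr_ge0 ?subr_ge0.
Qed.

(** Reversibility: on a pair of configurations differing only at [v], both sides equal the mass of
    the pair times the product of the averages of [f] and [g]. *)
Lemma heat_bath_adjoint v f g :
  \sum_s p s * (heat_bath p v f s * g s) = \sum_s p s * (f s * heat_bath p v g s).
Proof.
apply: (@mulfI _ 2) => //; rewrite -!(sum_set_spin v).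
apply: eq_bigr => s _; rewrite !heat_bath_set_spin /heat_bath; field.
exact/lt0r_neq0/two_spins_gt0.
Qed.

(** The tower property for the event of a plus at [v]. *)
Lemma sum_fiber_heat_bath v l s : v \notin l ->
  \sum_(r | fiber (v :: l) s r) p r * heat_bath p v (fun r => (r v)%:R) r =
  \sum_(r | fiber l (set_spin v true s) r) p r.
Proof.
move=> vl; rewrite sum_fiber_cons // !sum_fiber_shift // -big_split /=.
apply: eq_bigr => r /fiberP rs; rewrite heat_bath_set_spin /heat_bath !set_spinE.
rewrite (@set_spin_id _ v false r) ?rs ?set_spinE //=.
field; have := two_spins_gt0 v r.
by rewrite (@set_spin_id _ v false r) ?rs ?set_spinE // => /lt0r_neq0.
Qed.

End HeatBath.

(** * Restriction to [H] and comparison of the updates on [H] and on the whole graph *)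

Section Restriction.
Variables (R : realType) (V : finType) (H : {set V}).

Lemma restrict_set_spin (v : verts H) b (s : config V) :
  restrict_config H (set_spin (val v) b s) = set_spin v b (restrict_config H s).
Proof. by apply/ffunP => u; rewrite !ffunE val_eqE. Qed.

Lemma restrict_set_spin_out v b (s : config V) : v \notin H ->
  restrict_config H (set_spin v b s) = restrict_config H s.
Proof.
move=> vH; apply/ffunP => u; rewrite !ffunE.
by case: eqP => // uv; rewrite -uv (valP u) in vH.
Qed.

Lemma restrict_mono (s s' : config V) : config_le s s' ->
  config_le (restrict_config H s) (restrict_config H s').
Proof. by move=> ss' u; rewrite !ffunE; apply: ss'. Qed.

Lemma restrict_surj (r : config (verts H)) : exists s, restrict_config H s = r.
Proof.
exists [ffun u => if insub u is Some x then r x else false].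
by apply/ffunP => u; rewrite !ffunE valK.
Qed.

Lemma fiber_restrict (s r : config V) :
  fiber (enum (~: H)) s r = (restrict_config H r == restrict_config H s).
Proof.
apply/fiberP/eqP => [h|h u].
  by apply/ffunP => u; rewrite !ffunE h // mem_enum inE negbK (valP u).
rewrite mem_enum inE negbK => uH.
by have := congr1 (fun c : config (verts H) => c (Sub u uH)) h; rewrite !ffunE.
Qed.

Lemma sum_restrict (F : config V -> R) :
  \sum_s F s = \sum_(r : config (verts H)) \sum_(s | restrict_config H s == r) F s.
Proof. exact: partition_big. Qed.

Variables (p : config V -> R) (q : config (verts H) -> R).
Hypotheses (p_gt0 : forall s, 0 < p s) (q_gt0 : forall r, 0 < q r).
Hypotheses (p_attr : attractive p) (pq : marginal H p = q).

(* The left-hand side corresponds to resampling [v] together with all of the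
   complement of [H], of which resampling [v] alone is a censored version. *)
Lemma heat_bath_sub_le (v : verts H) (f : config (verts H) -> R) g :
  increasing f -> increasing g ->
  \sum_s p s * (heat_bath q v f (restrict_config H s) * g s) <=
  \sum_s p s * (heat_bath p (val v) (f \o restrict_config H) s * g s).
Proof.
move=> fi gi; rewrite -subr_ge0 -sumrB.
(* [a] and [c] are the conditional probabilities of a plus at [v] under [p] and [q], and [D] is the
   increment of [f] at [v]; the two updates of [f] differ by [(a - c) * D]. *)
pose a := heat_bath p (val v) (fun r => (r (val v))%:R).
pose c := heat_bath q v (fun r => (r v)%:R).
pose D r := f (set_spin v true r) - f (set_spin v false r).
under eq_bigr => s _.
  rewrite (_ : _ - _ = p s * ((a s - c (restrict_config H s))
    * D (restrict_config H s) * g s)); last first.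
    rewrite [heat_bath q v f _]heat_bath_affine //.
    rewrite [heat_bath p _ (f \o _) _]heat_bath_affine //=.
    rewrite !restrict_set_spin -/(a s) -/(c _) /D; ring.
  over.
(* Pairing the restrictions that differ only at [v] gives fibers on which [v] and the outside of [H]
   are free, while [c] and [D] are constant. *)
rewrite sum_restrict -(pmulr_rge0 _ (ltr0Sn R 1)) -(sum_set_spin v).
apply: sumr_ge0 => r0 _; have [s0 s0r0] := restrict_surj r0.
have vl : val v \notin enum (~: H) by rewrite mem_enum inE negbK (valP v).
have fibE b : (fun s => restrict_config H s == set_spin v b r0) =1
    fiber (enum (~: H)) (set_spin (val v) b s0).
  by move=> s; rewrite fiber_restrict restrict_set_spin s0r0.
rewrite !(eq_bigl _ _ (fibE _)) -sum_fiber_cons //.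
set l := val v :: _.
have res s b : fiber l s0 s ->
    set_spin v b (restrict_config H s) = set_spin v b r0.
  move=> /fiberP h; apply/ffunP => u; rewrite -s0r0 !ffunE; case: eqP => // /eqP uv.
  by apply: h; rewrite in_cons negb_or val_eqE uv mem_enum inE negbK (valP u).
under eq_bigr => s sl.
  rewrite (_ : _ * _ = D r0 * (p s * (a s * g s)) - D r0 * c r0 * (p s * g s)).
    over.
  rewrite (_ : c (restrict_config H s) = c r0); last first.
    by rewrite -[LHS](@heat_bath_set_spin _ _ _ v true) res // heat_bath_set_spin.
  by rewrite (_ : D (restrict_config H s) = D r0) /D ?res //; ring.
rewrite sumrB -!mulr_sumr -mulrA -mulrBr mulr_ge0 //.
  by rewrite subr_ge0; apply/fi/set_spin_false_le/set_spin_true_ge.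
rewrite subr_ge0 -(ler_pM2l (sum_fiber_gt0 p_gt0 l s0)).
have ul : uniq l by rewrite /= vl enum_uniq.
have ai : increasing a.
  apply: heat_bath_increasing => // s s' ss'; rewrite ler_nat.
  by move: (ss' (val v)); case: (s _) => // ->.
(* It remains to see that [c r0] times the mass of the fiber is the mass of its plus half, which
   follows from [q] being the marginal of [p]. *)
apply: le_trans (FKG p_gt0 p_attr s0 ul ai gi).
rewrite mulrA /a sum_fiber_heat_bath // sum_fiber_cons //.
rewrite -!(eq_bigl _ _ (fibE _)) -!/(marginal H p _) pq /c /heat_bath !set_spinE.
rewrite mulr1 mulr0 addr0 mulrCA mulfV ?mulr1 //.
exact/lt0r_neq0/two_spins_gt0.
Qed.

End Restriction.

(** * The Ising measure *)

Section Ising.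
Variables (R : realType) (V : finType) (e : rel V) (beta : R).
Implicit Types (v : V) (s : config V) (mu g : config V -> R).

Lemma ising_weight_sum_gt0 : 0 < \sum_(s : config V) ising_weight e beta s.
Proof.
rewrite (bigD1 (all_plus V)) //= ltr_pwDl ?expR_gt0 // sumr_ge0 // => s _.
exact: expR_ge0.
Qed.

Lemma ising_gt0 s : 0 < ising e beta s.
Proof. by rewrite divr_gt0 ?expR_gt0 ?ising_weight_sum_gt0. Qed.

Lemma sum_ising : \sum_s ising e beta s = 1.
Proof. by rewrite -mulr_suml mulfV // gt_eqF ?ising_weight_sum_gt0. Qed.

Lemma spin_le (b c : bool) : (b -> c) -> spin R b <= spin R c.
Proof. by case: b; case: c => // h; rewrite /spin; [have := h isT | lra]. Qed.

(** Edge by edge: an edge away from [v] contributes equally to both sides, and an edge from [v] to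
    [y] reduces to comparing the spins of [s] and [s'] at [y]. *)
Lemma edge_sum_supermodular v s s' : config_le s s' ->
  edge_sum R e (set_spin v true s) + edge_sum R e (set_spin v false s') <=
  edge_sum R e (set_spin v true s') + edge_sum R e (set_spin v false s).
Proof.
move=> ss'; rewrite /edge_sum -!mulrDr ler_pM2l ?invr_gt0 //.
rewrite -!big_split /=; apply: ler_sum => x _.
rewrite -!big_split /=; apply: ler_sum => y _; rewrite !ffunE.
have [_|xv] := eqVneq x v; have [_|yv] := eqVneq y v;
  rewrite /= ?/(spin R true) ?/(spin R false).
- lra.
- by have := spin_le (ss' y); lra.
- by have := spin_le (ss' x); lra.
- by rewrite addrC.
Qed.

Lemma ising_attractive : 0 <= beta -> attractive (ising e beta).
Proof.
move=> beta_ge0 v s s' ss'; rewrite /ising !mulf_div ler_pM2r; last first.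
  by rewrite invr_gt0 mulr_gt0 ?ising_weight_sum_gt0.
rewrite /ising_weight -!expRD -!(mulrDr beta) ler_expR ler_wpM2l //.
exact: edge_sum_supermodular.
Qed.

Lemma heat_bath_ising_increasing v g : 0 <= beta -> increasing g ->
  increasing (heat_bath (ising e beta) v g).
Proof.
by move=> /ising_attractive; apply: heat_bath_increasing; apply: ising_gt0.
Qed.

Lemma agree_offE v s s' : agree_off v s s' = fiber [:: v] s s'.
Proof. by apply: eq_forallb => u; rewrite inE implyNb [s u == _]eq_sym. Qed.

Lemma agree_offC v s s' : agree_off v s s' = agree_off v s' s.
Proof. by apply: eq_forallb => u; rewrite [s u == _]eq_sym. Qed.

Lemma sum_agree_off v s g : \sum_(r | agree_off v s r) g r =
  g (set_spin v true s) + g (set_spin v false s).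
Proof.
by rewrite (eq_bigl _ _ (agree_offE v s)) sum_fiber_cons // !sum_fiber_nil.
Qed.

Lemma heat_bath_agree_off (p : config V -> R) v g s :
  heat_bath p v g s = (\sum_(r | agree_off v s r) p r * g r) /
                      \sum_(r | agree_off v s r) p r.
Proof. by rewrite !sum_agree_off. Qed.

(** The update of laws is dual to the update of observables. *)
Lemma resample_pairing mu v g :
  \sum_s resample e beta mu v s * g s =
  \sum_s mu s * heat_bath (ising e beta) v g s.
Proof.
under eq_bigr do rewrite mulr_suml.
rewrite exchange_big /=; apply: eq_bigr => s _.
under eq_bigr do rewrite -mulrA.
rewrite -mulr_sumr; congr (_ * _); rewrite heat_bath_agree_off mulr_suml.
rewrite [RHS]big_mkcond; apply: eq_bigr => r _; rewrite /resample_kernel.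
by case: ifP => _; rewrite ?mul0r // mulrAC.
Qed.

(** By reversibility the density is itself updated by [heat_bath], so that increasing densities stay
    increasing when [beta] is nonnegative. *)
Lemma resample_density mu v s :
  resample e beta mu v s / ising e beta s =
  heat_bath (ising e beta) v (fun r => mu r / ising e beta r) s.
Proof.
rewrite heat_bath_agree_off mulr_suml mulr_suml [RHS]big_mkcond.
apply: eq_bigr => r _; rewrite /resample_kernel agree_offC; case: ifP => sr; last first.
  by rewrite mulr0 mul0r.
have -> : \sum_(t | agree_off v r t) ising e beta t = \sum_(t | agree_off v s t) ising e beta t.
  apply: eq_bigl => t; apply/forallP/forallP => h u; move/forallP/(_ u): sr (h u);
  by case: (u != v) => //= /eqP ->.
have Z0 : \sum_(t | agree_off v s t) ising e beta t != 0.
  by rewrite sum_agree_off gt_eqF // addr_gt0 ?ising_gt0.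
have s0 := lt0r_neq0 (ising_gt0 s); have r0 := lt0r_neq0 (ising_gt0 r).
by field; rewrite Z0 s0 r0.
Qed.

Lemma resample_ge0 mu v : (forall s, 0 <= mu s) -> forall s, 0 <= resample e beta mu v s.
Proof.
move=> mu0 s; apply: sumr_ge0 => r _; rewrite mulr_ge0 // /resample_kernel.
case: ifP => // _; rewrite divr_ge0 ?ltW ?ising_gt0 //.
by rewrite sum_agree_off addr_gt0 ?ising_gt0.
Qed.

Lemma sum_resample mu v : \sum_s resample e beta mu v s = \sum_s mu s.
Proof.
have := resample_pairing mu v (fun=> 1).
under eq_bigr do rewrite mulr1.
move=> ->; apply: eq_bigr => s _.
by rewrite /heat_bath !mulr1 mulfV ?mulr1 // gt_eqF // addr_gt0 ?ising_gt0.
Qed.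

End Ising.

(** * The marginal of the Ising measure on [H] *)

Section IsingMarginal.
Variables (R : realType) (V : finType) (e : rel V) (beta : R).
Hypotheses (e_sym : symmetric e).
Variable H : {set V}.
Hypothesis H_attach : (#|attachment e H| <= 1)%N.
Local Notation eH := (induced_rel H e).

(* When [c] tells whether [r'] and [s] disagree at the attachment vertex, this
   preserves the spin product of every edge not inside [H]. *)
Definition transplant (c : bool) (r' : config (verts H)) (s : config V) : config V :=
  [ffun u => if insub u is Some x then r' x else s u (+) c].

Lemma transplant_in c r' s (x : verts H) : transplant c r' s (val x) = r' x.
Proof. by rewrite ffunE valK. Qed.

Lemma transplant_out c r' s u : u \notin H -> transplant c r' s u = s u (+) c.
Proof. by move=> uH; rewrite ffunE insubN. Qed.

Lemma restrict_transplant c r' s : restrict_config H (transplant c r' s) = r'.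
Proof. by apply/ffunP => x; rewrite ffunE transplant_in. Qed.

Lemma transplantK c r r' s : restrict_config H s = r ->
  transplant c r (transplant c r' s) = s.
Proof.
move=> sr; apply/ffunP => u; case: (boolP (u \in H)) => uH; last first.
  by rewrite !transplant_out // -addbA addbb addbF.
by rewrite -[u in LHS](SubK (verts H) uH) transplant_in -sr ffunE.
Qed.

(** Edges lying wholly outside [H] are included. *)
Definition boundary_sum (s : config V) : R :=
  2^-1 * \sum_u \sum_(v | e u v && ~~ ((u \in H) && (v \in H)))
    spin R (s u) * spin R (s v).

Lemma edge_sum_split (s : config V) :
  edge_sum R e s = edge_sum R eH (restrict_config H s) + boundary_sum s.
Proof.
rewrite /edge_sum /boundary_sum -mulrDr; congr (_ * _).
have -> : \sum_u \sum_(v | eH u v)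
      spin R (restrict_config H s u) * spin R (restrict_config H s v) =
    \sum_u \sum_(v | e u v && ((u \in H) && (v \in H)))
      spin R (s u) * spin R (s v).
  rewrite [RHS](bigID (mem H)) /= [X in _ = _ + X]big1 ?addr0; last first.
    by move=> u /negbTE uH; rewrite big1 // => v; rewrite uH andbF.
  rewrite [RHS](big_sub (mem H)); apply: eq_bigr => u _.
  under [RHS]eq_bigl => v do rewrite (valP u) andbC.
  rewrite [RHS](big_sub_cond (mem H)); apply: eq_bigr => v _.
  by rewrite !ffunE.
rewrite -big_split /=; apply: eq_bigr => u _.
by rewrite [LHS](bigID (fun v => (u \in H) && (v \in H))).
Qed.

Lemma boundary_sum_transplant c (r r' : config (verts H)) (s : config V) :
  restrict_config H s = r ->
  (forall x, val x \in attachment e H -> r' x = r x (+) c) ->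
  boundary_sum (transplant c r' s) = boundary_sum s.
Proof.
move=> sr rr'; congr (_ * _); apply: eq_bigr => u _; apply: eq_bigr => v.
move=> /andP[uv uvH].
(* Both endpoints of an edge not inside [H] are flipped according to [c]: one outside by
   construction, one in [H] because it is an attachment vertex. *)
suff flip z z' : e z z' -> ~~ ((z \in H) && (z' \in H)) ->
    transplant c r' s z = s z (+) c.
  have -> := flip u v uv uvH.
  have -> : transplant c r' s v = s v (+) c by apply: (flip v u); rewrite 1?e_sym 1?andbC.
  by rewrite /spin; case: (s u); case: (s v); case: (c); rewrite /= ?mulrNN ?mulNr ?mulrN.
move=> zz' zzH; case: (boolP (z \in H)) => zH; last by rewrite transplant_out.
rewrite zH /= in zzH; rewrite -[z](SubK (verts H) zH) transplant_in rr'.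
  by rewrite -sr ffunE.
by rewrite SubK inE zH; apply/existsP; exists z'; rewrite zzH.
Qed.

Lemma sum_boundary_const (r r' : config (verts H)) :
  \sum_(s | restrict_config H s == r) expR (beta * boundary_sum s) =
  \sum_(s | restrict_config H s == r') expR (beta * boundary_sum s).
Proof.
have [c rr'] : exists c, forall x, val x \in attachment e H -> r' x = r x (+) c.
  have [x xa|no] := pickP (fun x : verts H => val x \in attachment e H); last first.
    by exists false => x; rewrite no.
  (* [c] records whether [r] and [r'] disagree at the only attachment vertex. *)
  exists (r x (+) r' x) => y ya; have -> : y = x.
    by apply/val_inj; apply: (card_le1_eqP H_attach).
  by rewrite addbA addbb.
rewrite [RHS](reindex_onto (transplant c r') (transplant c r)) /=; last first.
  by move=> s /eqP; apply: transplantK.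
apply: eq_big => s.
  rewrite restrict_transplant eqxx; apply/eqP/eqP => [/transplantK //|<-].
  exact: restrict_transplant.
by move=> /eqP sr; rewrite (boundary_sum_transplant sr rr').
Qed.

Lemma marginal_ising : marginal H (ising e beta) = ising eH beta.
Proof.
pose K := \sum_(s | restrict_config H s == all_plus _) expR (beta * boundary_sum s).
have weightE r : marginal H (ising_weight e beta) r = K * ising_weight eH beta r.
  rewrite /K (sum_boundary_const _ r) mulr_suml; apply: eq_bigr => s /eqP sr.
  by rewrite /ising_weight edge_sum_split sr mulrDr expRD mulrC.
have K0 : K != 0.
  have := ising_weight_sum_gt0 e beta; rewrite (sum_restrict H).
  rewrite (eq_bigr _ (fun r _ => weightE r)) -mulr_sumr.
  by apply: contraTneq => ->; rewrite mul0r ltxx.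
apply/funext => r; rewrite /marginal /ising -mulr_suml (sum_restrict H).
rewrite -/(marginal H _ r) weightE (eq_bigr _ (fun r _ => weightE r)) -mulr_sumr.
by rewrite -mulf_div mulfV // mul1r.
Qed.

End IsingMarginal.

(** * Sums over words of clock rings *)

Section Sums.
Variable R : realType.

(** Pascal's rule; with [d] the number of vertices outside [H] and [j] the number of letters in [H],
    the two terms correspond to a first letter outside or inside [H]. *)
Lemma sum_binS (d : R) (y : nat -> R) k :
  \sum_(j < k.+2) 'C(k.+1, j)%:R * d ^+ (k.+1 - j) * y j =
  d * (\sum_(j < k.+1) 'C(k, j)%:R * d ^+ (k - j) * y j) +
  \sum_(j < k.+1) 'C(k, j)%:R * d ^+ (k - j) * y j.+1.
Proof.
rewrite big_ord_recl /= bin0 subn0.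
under eq_bigr => j _ do rewrite /bump /= add1n subSS binS natrD 2!mulrDl.
rewrite big_split /= addrA; congr (_ + _).
rewrite big_ord_recr /= bin_small // !mul0r addr0 [in RHS]big_ord_recl /= bin0 subn0.
rewrite mulrDr exprS !mulrA mulr1 mul1r; congr (_ + _).
rewrite mulr_sumr; apply: eq_bigr => j _; rewrite /bump /= add1n.
have -> : (k - j = (k - j.+1).+1)%N by rewrite subnSK.
by rewrite exprS; ring.
Qed.

Lemma sum_cauchy_product (x y : nat -> R) n :
  \sum_(k < n) \sum_(j < k.+1) x (k - j)%N * y j =
  \sum_(j < n) (\sum_(i < n - j) x i) * y j.
Proof.
elim: n => [|n IH]; first by rewrite !big_ord0.
rewrite big_ord_recr /= IH [in RHS]big_ord_recr /= [in LHS]big_ord_recr /=.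
rewrite subnn subSn // subnn addrA -big_split /= big_ord1; congr (_ + _).
by apply: eq_bigr => j _; rewrite (subSn (ltnW (ltn_ord j))) big_ord_recr mulrDl.
Qed.

(** The index square of side [n] lies in the triangle of side [n + n]. *)
Lemma le_cauchy_product (x y : nat -> R) n :
  (forall i, 0 <= x i) -> (forall j, 0 <= y j) ->
  (\sum_(i < n) x i) * (\sum_(j < n) y j) <=
  \sum_(k < n + n) \sum_(j < k.+1) x (k - j)%N * y j.
Proof.
move=> x0 y0; rewrite sum_cauchy_product mulr_sumr big_split_ord /=.
rewrite ler_wpDr //.
  by apply: sumr_ge0 => j _; rewrite mulr_ge0 ?sumr_ge0.
apply: ler_sum => j _; rewrite ler_wpM2r // -addnBA ?(ltnW (ltn_ord j)) //.
by rewrite big_split_ord /= lerDl sumr_ge0.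
Qed.

End Sums.

Lemma card_verts (V : finType) (H : {set V}) : (#|verts H| + #|~: H| = #|V|)%N.
Proof. by rewrite card_sig -(cardsC H); congr (_ + _)%N; apply: eq_card. Qed.

Lemma sum_count_mem (T : finType) (w : seq T) :
  (\sum_(v : T) count_mem v w)%N = size w.
Proof.
elim: w => [|x w IH]; first by rewrite big1.
rewrite big_split /= IH -add1n; congr (_ + _)%N.
by rewrite (bigD1 x) //= eqxx big1 // => v /negbTE; rewrite eq_sym => ->.
Qed.

Section Words.
Variables (R : realType) (V : finType) (e : rel V) (beta : R).
Implicit Types (mu g : config V -> R) (s : config V).

Definition word_sum mu k s : R :=
  \sum_(w : k.-tuple V) foldl (resample e beta) mu w s.

Lemma word_sum0 mu s : word_sum mu 0 s = mu s.
Proof.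
rewrite /word_sum (big_pred1 [tuple]) //= => w.
by apply/esym/eqP; apply: tuple0.
Qed.

Lemma word_sumS mu k s :
  word_sum mu k.+1 s = \sum_v word_sum (resample e beta mu v) k s.
Proof.
rewrite /word_sum pair_big /= (reindex (fun vw : V * k.-tuple V => cons_tuple vw.1 vw.2)) //=.
exists (fun w : k.+1.-tuple V => (thead w, behead_tuple w)) => [[v w] _|w _] /=.
  by rewrite theadE; congr (_, _); apply: val_inj.
by rewrite [RHS]tuple_eta; apply: val_inj.
Qed.

Lemma word_sum_ge0 mu k s : (forall s, 0 <= mu s) -> 0 <= word_sum mu k s.
Proof.
elim: k mu => [|k IH] mu mu0; first by rewrite word_sum0.
by rewrite word_sumS sumr_ge0 // => v _; apply/IH/resample_ge0.
Qed.

Lemma sum_word_sum mu k : \sum_s word_sum mu k s = #|V|%:R ^+ k * \sum_s mu s.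
Proof.
elim: k mu => [|k IH] mu.
  by rewrite mul1r; apply: eq_bigr => s _; rewrite word_sum0.
under eq_bigr do rewrite word_sumS.
rewrite exchange_big /=; under eq_bigr do rewrite IH sum_resample.
by rewrite sumr_const exprS -mulrA mulr_natl.
Qed.

Lemma word_sum_increasing mu k : 0 <= beta ->
  increasing (fun s => mu s / ising e beta s) ->
  increasing (fun s => word_sum mu k s / ising e beta s).
Proof.
move=> beta_ge0; elim: k mu => [|k IH] mu mui s s' ss'.
  by rewrite !word_sum0; apply: mui.
rewrite !word_sumS !mulr_suml; apply: ler_sum => v _; apply: IH => // r r' rr'.
by rewrite !resample_density; apply: heat_bath_ising_increasing.
Qed.

(** The factorials of the letter counts cancel: given its length, the word of rings is uniform. *)
Lemma clock_prob_tuple (t : R) k (w : k.-tuple V) :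
  clock_prob t w = expR (- (#|V|%:R * t)) * (t ^+ k / k`!%:R).
Proof.
rewrite /clock_prob size_tuple natr_prod [LHS]mulrA -big_split /=.
under eq_bigr => v _ do rewrite divfK ?pnatr_eq0 -?lt0n ?fact_gt0 //.
rewrite big_split /= prodr_const -expRM_natl mulrN -!mulrA; congr (_ * (_ / _)).
rewrite prodrXr; congr (_ ^+ _).
by rewrite sum_count_mem size_tuple.
Qed.

End Words.

(** * The continuous-time law *)

Section Law.
Variables (R : realType) (V : finType) (e : rel V) (beta : R) (s0 : config V) (t : R).
Hypothesis t_ge0 : 0 <= t.
Local Notation law := (glauber_law e beta s0 t).
Local Notation word_law := (word_sum e beta (dirac_pmf R s0)).

Lemma dirac_ge0 s : 0 <= dirac_pmf R s0 s.
Proof. exact: ler0n. Qed.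

Lemma sum_dirac g : \sum_s dirac_pmf R s0 s * g s = g s0.
Proof.
rewrite (bigD1 s0) //= /dirac_pmf eqxx mul1r big1 ?addr0 // => s /negbTE ->.
by rewrite mul0r.
Qed.

Lemma sum_word_law k : \sum_s word_law k s = #|V|%:R ^+ k.
Proof.
rewrite sum_word_sum -[RHS]mulr1; congr (_ * _).
by rewrite -(sum_dirac (fun=> 1)); apply: eq_bigr => s _; rewrite mulr1.
Qed.

(** The exponential factor undoes the Poisson normalisation. Since [word_law k s] is at most
    [#|V|%:R ^+ k], the exponential series dominates, which makes the [limn] in [glauber_law] a
    genuine limit. *)
Lemma glauber_law_cvg s :
  series (fun k => t ^+ k / k`!%:R * word_law k s) @ \oo -->
  expR (#|V|%:R * t) * law s.
Proof.
set u := fun k => _.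
have u_cvg : cvgn (series u).
  apply: (@series_le_cvg _ _ (exp_coeff (#|V|%:R * t))) (is_cvg_series_exp_coeff _) => k.
  - by rewrite mulr_ge0 ?divr_ge0 ?exprn_ge0 ?ler0n // word_sum_ge0 // => ?; apply: dirac_ge0.
  - by rewrite exp_coeff_ge0 ?mulr_ge0.
  rewrite /exp_coeff /= exprMn -mulrA [leRHS]mulrC ler_wpM2l ?divr_ge0 ?exprn_ge0 //.
  rewrite -sum_word_law (bigD1 s) //= lerDl sumr_ge0 // => r _.
  by rewrite word_sum_ge0 // => ?; apply: dirac_ge0.
suff -> : expR (#|V|%:R * t) * law s = limn (series u) by [].
rewrite /glauber_law; set U := fun k => _.
have -> : U = expR (- (#|V|%:R * t)) *: u.
  apply/funext => k; rewrite /U /u /word_sum.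
  under eq_bigr do rewrite clock_prob_tuple.
  by rewrite -mulr_sumr -mulrA.
rewrite lim_seriesZ // /GRing.scale /= mulrA -expRD subrr expR0 mul1r //.
Qed.

Lemma glauber_mean_cvg g :
  series (fun k => t ^+ k / k`!%:R * \sum_s word_law k s * g s) @ \oo -->
  expR (#|V|%:R * t) * \sum_s law s * g s.
Proof.
rewrite mulr_sumr; under eq_bigr do rewrite mulrA.
have -> : series (fun k => t ^+ k / k`!%:R * \sum_s word_law k s * g s) =
    fun n => \sum_s series (fun k => t ^+ k / k`!%:R * word_law k s) n * g s.
  apply/funext => n; rewrite /series /=.
  under [RHS]eq_bigr do rewrite mulr_suml.
  rewrite exchange_big /=; apply: eq_bigr => k _; rewrite mulr_sumr.
  by apply: eq_bigr => s _; rewrite mulrA.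
apply: cvg_big => [|s _]; first exact: add_continuous.
by apply: cvgMr_tmp; apply: glauber_law_cvg.
Qed.

Lemma glauber_mean_ge0 g : (forall k, 0 <= \sum_s word_law k s * g s) ->
  0 <= \sum_s law s * g s.
Proof.
move=> g0; rewrite -(pmulr_rge0 _ (expR_gt0 (#|V|%:R * t))).
have := glauber_mean_cvg (g := g).
set u := series _ => cu; rewrite -(cvg_lim _ cu) //.
apply: limr_ge; first by apply/cvg_ex; eexists; exact: cu.
apply: nearW => n; rewrite /u /series /= sumr_ge0 // => k _.
by rewrite mulr_ge0 ?divr_ge0 ?exprn_ge0 ?ler0n.
Qed.

Lemma sum_glauber_law : \sum_s law s = 1.
Proof.
have := glauber_mean_cvg (g := fun=> 1).
under eq_bigr do rewrite mulr1.
have -> : (fun k => t ^+ k / k`!%:R * \sum_s word_law k s * 1) =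
    exp_coeff (#|V|%:R * t).
  apply/funext => k; under eq_bigr do rewrite mulr1.
  by rewrite sum_word_law /exp_coeff /= exprMn [LHS]mulrC mulrA.
move=> /cvg_lim h; apply: (mulfI (lt0r_neq0 (expR_gt0 (#|V|%:R * t)))).
by rewrite mulr1 -h.
Qed.


End Law.

(** * Comparison of the dynamics on H and on G *)

Section Comparison.
Variables (R : realType) (V : finType) (e : rel V) (H : {set V}) (beta : R).
Hypotheses (e_sym : symmetric e) (H_attach : (#|attachment e H| <= 1)%N).
Hypothesis beta_ge0 : 0 <= beta.
Local Notation eH := (induced_rel H e).
Local Notation p := (ising e beta).
Local Notation q := (ising eH beta).
Implicit Types (nu : config (verts H) -> R) (mu : config V -> R).

(* The left-hand side is the mean of [g] when the spins on [H] have law [nu]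
   and, given these, the others follow the conditional law under [p]. *)
Definition dominated nu mu : Prop :=
  forall g, increasing g ->
    \sum_s p s * (nu (restrict_config H s) / q (restrict_config H s) * g s) <=
    \sum_s mu s * g s.

(** Reversibility moves the update onto the density, which depends only on the spins on [H] and is
    thus fixed by it. *)
Lemma dominated_resample_out nu mu v : v \notin H ->
  dominated nu mu -> dominated nu (resample e beta mu v).
Proof.
move=> vH dom g gi; rewrite resample_pairing.
apply: le_trans (dom _ (heat_bath_ising_increasing e (v) beta_ge0 gi)).
rewrite -heat_bath_adjoint; last exact: ising_gt0.
apply: ler_sum => s _; rewrite heat_bath_affine; last exact: ising_gt0.
by rewrite !restrict_set_spin_out // subrr mulr0 addr0.
Qed.

(** The censoring step: reversibility moves the update onto the density, where [heat_bath_sub_le]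
    compares it with the update on [H] alone, using that the density is increasing. *)
Lemma dominated_resample_in nu mu (v : verts H) :
  increasing (fun r => nu r / q r) -> dominated nu mu ->
  dominated (resample eH beta nu v) (resample e beta mu (val v)).
Proof.
move=> nui dom g gi; rewrite resample_pairing.
apply: le_trans (dom _ (heat_bath_ising_increasing e (val v) beta_ge0 gi)).
rewrite -heat_bath_adjoint; last exact: ising_gt0.
under eq_bigr do rewrite resample_density.
apply: (heat_bath_sub_le (@ising_gt0 _ _ _ _) (@ising_gt0 _ _ _ _)) => //.
- exact: ising_attractive.
- exact: marginal_ising.
Qed.

(** Only the subword of letters in [H] acts on [nu]: a subword of length [j] extends to a word of
    length [k] by choosing its positions and the other [k - j] letters, whence the coefficients. *)
Lemma dominated_word_sum nu mu k :
  increasing (fun r => nu r / q r) -> dominated nu mu ->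
  dominated (fun r => \sum_(j < k.+1)
      'C(k, j)%:R * #|~: H|%:R ^+ (k - j) * word_sum eH beta nu j r)
    (word_sum e beta mu k).
Proof.
elim: k nu mu => [|k IH] nu mu nui dom g gi.
  under eq_bigr do rewrite big_ord1 bin0 subnn expr0 !mul1r word_sum0.
  by under [leRHS]eq_bigr do rewrite word_sum0; apply: dom.
pose L nu' := \sum_s p s * (nu' (restrict_config H s) / q (restrict_config H s) * g s).
pose pad nu' r := \sum_(j < k.+1)
  'C(k, j)%:R * #|~: H|%:R ^+ (k - j) * word_sum eH beta nu' j r.
have -> : \sum_s p s * ((\sum_(j < k.+2) 'C(k.+1, j)%:R * #|~: H|%:R ^+ (k.+1 - j) *
      word_sum eH beta nu j (restrict_config H s)) / q (restrict_config H s) * g s) =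
    #|~: H|%:R * L (pad nu) + \sum_(v : verts H) L (pad (resample eH beta nu v)).
  rewrite /L exchange_big mulr_sumr -big_split /=; apply: eq_bigr => s _.
  rewrite (sum_binS _ (fun j => word_sum eH beta nu j (restrict_config H s))) -/(pad nu _).
  have -> : \sum_(j < k.+1) 'C(k, j)%:R * #|~: H|%:R ^+ (k - j) *
      word_sum eH beta nu j.+1 (restrict_config H s) =
      \sum_(v : verts H) pad (resample eH beta nu v) (restrict_config H s).
    rewrite /pad exchange_big /=; apply: eq_bigr => j _.
    by rewrite word_sumS mulr_sumr.
  rewrite -mulr_sumr -mulr_suml -mulr_suml; ring.
pose M v := \sum_s word_sum e beta (resample e beta mu v) k s * g s.
have -> : \sum_s word_sum e beta mu k.+1 s * g s =
    \sum_(v | v \notin H) M v + \sum_(v : verts H) M (val v).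
  rewrite -(big_sub (mem H) M) addrC -(bigID (mem H) xpredT) /= exchange_big /=.
  by apply: eq_bigr => s _; rewrite word_sumS mulr_suml.
(* Compare by first letter: [nu] is kept if it lies outside [H] and resampled otherwise. *)
apply: lerD.
  rewrite mulr_natl -sumr_const; under eq_bigl do rewrite inE.
  apply: ler_sum => v vH; apply: (IH nu) => //; exact: dominated_resample_out.
apply: ler_sum => v _; apply: IH => //; last exact: dominated_resample_in.
by move=> r r' rr'; rewrite !resample_density; apply: heat_bath_ising_increasing.
Qed.

Lemma dirac_all_plus_increasing :
  increasing (fun r => dirac_pmf R (all_plus (verts H)) r / q r).
Proof.
move=> r r' rr'; rewrite /dirac_pmf; have [rp|_] := eqVneq r (all_plus _); last first.
  by rewrite mul0r divr_ge0 ?ler0n // ltW // ising_gt0.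
suff -> : r' = r by rewrite rp eqxx.
by apply/ffunP => u; rewrite rp ffunE; apply: rr'; rewrite rp ffunE.
Qed.

Lemma sum_lift nu (g : config (verts H) -> R) :
  \sum_s p s * (nu (restrict_config H s) / q (restrict_config H s) *
    g (restrict_config H s)) = \sum_r nu r * g r.
Proof.
rewrite (sum_restrict H); apply: eq_bigr => r _.
under eq_bigr => s /eqP -> do over.
rewrite -mulr_suml -/(marginal H p r) marginal_ising //.
by rewrite mulrA mulrCA mulfV ?mulr1 // gt_eqF ?ising_gt0.
Qed.

(** The point mass at the largest configuration dominates every law. *)
Lemma dominated_dirac :
  dominated (dirac_pmf R (all_plus (verts H))) (dirac_pmf R (all_plus V)).
Proof.
move=> g gi; rewrite sum_dirac.
apply: (@le_trans _ _ (\sum_s p s * (dirac_pmf R (all_plus (verts H))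
    (restrict_config H s) / q (restrict_config H s) * g (all_plus V)))).
  apply: ler_sum => s _; rewrite ler_wpM2l ?(ltW (ising_gt0 _ _ _)) // ler_wpM2l //.
    by rewrite divr_ge0 ?dirac_ge0 // ltW // ising_gt0.
  exact/gi/config_le_all_plus.
by rewrite (sum_lift _ (fun=> g (all_plus V))) sum_dirac.
Qed.

(** The binomial sums are, up to factorials, the Cauchy product of the series for [H] with the
    exponential series of [d * t], which counts the rings outside [H]. All terms being nonnegative,
    the inequality passes from partial sums to limits. *)
Lemma glauber_restrict_le t (g : config (verts H) -> R) : 0 <= t ->
  increasing g -> (forall r, 0 <= g r) ->
  \sum_r glauber_law eH beta (all_plus (verts H)) t r * g r <=
  \sum_s glauber_law e beta (all_plus V) t s * g (restrict_config H s).
Proof.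
move=> t0 gi g0.
pose d : R := #|~: H|%:R.
pose Y j := \sum_r word_sum eH beta (dirac_pmf R (all_plus (verts H))) j r * g r.
pose X k := \sum_s word_sum e beta (dirac_pmf R (all_plus V)) k s * g (restrict_config H s).
have Y0 j : 0 <= Y j.
  by apply: sumr_ge0 => r _; rewrite mulr_ge0 // word_sum_ge0 // => ?; apply: dirac_ge0.
have X0 k : 0 <= X k.
  by apply: sumr_ge0 => r _; rewrite mulr_ge0 // word_sum_ge0 // => ?; apply: dirac_ge0.
have XY k : \sum_(j < k.+1) 'C(k, j)%:R * d ^+ (k - j) * Y j <= X k.
  have gHi : increasing (g \o restrict_config H).
    by move=> s s' ss'; apply/gi/restrict_mono.
  have := dominated_word_sum k dirac_all_plus_increasing dominated_dirac gHi.
  rewrite (sum_lift (fun r => \sum_(j < k.+1) 'C(k, j)%:R * d ^+ (k - j) *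
    word_sum eH beta (dirac_pmf R (all_plus (verts H))) j r) g).
  apply: le_trans; rewrite le_eqVlt; apply/orP; left; apply/eqP.
  under [RHS]eq_bigr do rewrite mulr_suml.
  rewrite exchange_big /=; apply: eq_bigr => j _; rewrite mulr_sumr.
  by apply: eq_bigr => r _; rewrite mulrA.
have tk0 k : 0 <= t ^+ k / k`!%:R by rewrite divr_ge0 ?exprn_ge0.
have cvH := glauber_mean_cvg (e := eH) (beta := beta) (s0 := all_plus _) t0 (g := g).
have cvG := glauber_mean_cvg (e := e) (beta := beta) (s0 := all_plus _) t0
  (g := g \o restrict_config H).
have cvd := is_cvg_series_exp_coeff (d * t).
have partial n : series (exp_coeff (d * t)) n * series (fun k => t ^+ k / k`!%:R * Y k) n <=
    expR (#|V|%:R * t) * \sum_s glauber_law e beta (all_plus V) t s * g (restrict_config H s).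
  have le_lim : series (fun k => t ^+ k / k`!%:R * X k) (n + n) <=
      expR (#|V|%:R * t) * \sum_s glauber_law e beta (all_plus V) t s * g (restrict_config H s).
    rewrite -(cvg_lim _ cvG) //; apply: nondecreasing_cvgn_le.
      by apply: nondecreasing_series => k _ _; rewrite mulr_ge0.
    by apply/cvg_ex; eexists; exact: cvG.
  apply: le_trans le_lim; rewrite /series /= !big_mkord.
  apply: (@le_trans _ _ (\sum_(k < n + n) \sum_(j < k.+1)
      exp_coeff (d * t) (k - j)%N * (t ^+ j / j`!%:R * Y j))).
    apply: (@le_cauchy_product _ (exp_coeff (d * t)) (fun j => t ^+ j / j`!%:R * Y j)) => i.
      by rewrite exp_coeff_ge0 // mulr_ge0.
    by rewrite mulr_ge0.
  apply: ler_sum => k _; apply: le_trans (ler_wpM2l (tk0 k) (XY k)).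
  rewrite le_eqVlt; apply/orP; left; apply/eqP; rewrite mulr_sumr.
  apply: eq_bigr => -[j jk] _ /=; rewrite ltnS in jk.
  rewrite /exp_coeff /= -(bin_fact jk) !natrM exprMn -[in RHS](subnK jk) exprD addnK.
  have f0 m : m`!%:R != 0 :> R by rewrite pnatr_eq0 -lt0n fact_gt0.
  have b0 : 'C(k, j)%:R != 0 :> R by rewrite pnatr_eq0 -lt0n bin_gt0.
  by rewrite subnK //; field; rewrite !f0 b0.
have lim : expR (d * t) * (expR (#|verts H|%:R * t) *
    \sum_r glauber_law eH beta (all_plus (verts H)) t r * g r) <=
    expR (#|V|%:R * t) * \sum_s glauber_law e beta (all_plus V) t s * g (restrict_config H s).
  exact: ler_cvg_to (cvgM cvd cvH) (cvg_cst _) (nearW _ partial).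
(* The exponential factors cancel because the vertices of [H] and those outside add up to [V]. *)
move: lim; rewrite mulrA -expRD -mulrDl /d -natrD addnC card_verts.
by rewrite ler_pM2l ?expR_gt0.
Qed.

Lemma glauber_law_density_increasing t : 0 <= t ->
  increasing (fun r => glauber_law eH beta (all_plus (verts H)) t r / q r).
Proof.
move=> t0 r r' rr'.
(* A signed test function whose mean under a law is the increment of its density from [r] to
   [r']. *)
pose g x : R := (x == r')%:R / q r' - (x == r)%:R / q r.
have meanE nu : \sum_x nu x * g x = nu r' / q r' - nu r / q r.
  have pick y : \sum_x nu x * ((x == y)%:R / q y) = nu y / q y.
    rewrite (bigD1 y) //= eqxx mul1r big1 ?addr0 // => x /negbTE ->.
    by rewrite mul0r mulr0.
  by rewrite -!pick -sumrB; apply: eq_bigr => x _; rewrite mulrBr.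
rewrite -subr_ge0 -meanE; apply: glauber_mean_ge0 => // k.
rewrite meanE subr_ge0.
exact: (word_sum_increasing k beta_ge0 dirac_all_plus_increasing rr').
Qed.

Lemma mixing_time_sub_le_restr (eps : R) :
  (mixing_time_sub e H beta eps <= mixing_time_restr e H beta eps)%E.
Proof.
apply: ereal_inf_le_tmp => _ [t [t0 close] <-]; exists t => //; split => //.
apply: le_trans close; set lawH := glauber_law _ _ _ t; set lawG := marginal _ _.
have mass : \sum_r lawH r = \sum_r q r by rewrite sum_glauber_law // sum_ising.
(* The event where the density is at least 1 maximises the excess of [lawH] over [q]; it is
   increasing because the density is. *)
pose A := [set r | q r <= lawH r]%SET.
have lawH_le_A (B : {set config (verts H)}) :
    \sum_(r in B) lawH r - \sum_(r in B) q r <= \sum_(r in A) lawH r - \sum_(r in A) q r.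
  rewrite -!sumrB [leRHS]big_mkcond [leLHS]big_mkcond; apply: ler_sum => r _.
  by rewrite inE; have [h|/ltW h] := lerP (q r) (lawH r); case: ifP => _ //;
    rewrite ?subr_ge0 ?subr_le0.
have inA r : (r \in A) = (1 <= lawH r / q r).
  by rewrite inE ler_pdivlMr ?mul1r // ising_gt0.
have A_incr : increasing (fun r => (r \in A)%:R : R).
  move=> r r' /(glauber_law_density_increasing t0); rewrite -/lawH => rr'.
  rewrite ler_nat !inA; case: (boolP (1 <= lawH r / q r)) => // /le_trans/(_ rr') -> //.
have A_le : \sum_(r in A) lawH r <= \sum_(r in A) lawG r.
  have := glauber_restrict_le t0 A_incr (fun r => ler0n _ _).
  have sumA (f : config (verts H) -> R) :
      \sum_(r in A) f r = \sum_r f r * (r \in A)%:R.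
    by rewrite big_mkcond; apply: eq_bigr => r _; rewrite mulr_natr mulrb.
  rewrite !sumA => /le_trans; apply; rewrite (sum_restrict H).
  apply: ler_sum => r _; rewrite /lawG /marginal mulr_suml.
  by apply: ler_sum => s /eqP ->.
have tv_A : `|\sum_(r in A) lawG r - \sum_(r in A) marginal H p r| <=
    tv_dist lawG (marginal H p).
  exact: le_bigmax.
have A_tv : \sum_(r in A) lawH r - \sum_(r in A) q r <= tv_dist lawG (marginal H p).
  apply: le_trans tv_A; apply: le_trans (ler_norm _).
  by rewrite marginal_ising // lerB.
apply: bigmax_le => [|B _].
  by apply: le_trans tv_A; apply: normr_ge0.
rewrite ler_norml; apply/andP; split; last exact: le_trans (lawH_le_A B) A_tv.
(* As the total masses agree, a deficit on [B] is an excess on its complement. *)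
rewrite lerNl opprB; apply: le_trans A_tv; apply: le_trans (lawH_le_A (~: B)).
have splitB (f : config (verts H) -> R) :
    \sum_(r in ~: B) f r = \sum_r f r - \sum_(r in B) f r.
  rewrite [X in _ = X - _](bigID (mem B)) /= [X in X - _]addrC addrK.
  by apply: eq_bigl => r; rewrite inE.
by rewrite !splitB mass; lra.
Qed.

End Comparison.

Theorem theorem3p4 (R : realType) (V : finType) (e : rel V)
    (e_sym : symmetric e) (e_irr : irreflexive e)
    (H : {set V}) (H_attach : (#|attachment e H| <= 1)%N)
    (beta : R) (beta_ge0 : 0 <= beta)
    (eps : R) (eps_gt0 : 0 < eps) (eps_lt1 : eps < 1) :
  (mixing_time_sub e H beta eps <= mixing_time_restr e H beta eps)%E.
Proof. exact: mixing_time_sub_le_restr. Qed.
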